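(* Let $n\ge 2$ and let $\boldsymbol{\pi}\in\mathfrak{S}_n$ be an $Ln1$ permutation. Then the relative volume of $\triangle=\operatorname{conv}(\mathcal{S}^{\boldsymbol{\pi}})$ is $1$.
   Context: Permutations $\boldsymbol{\pi}=\pi_1\cdots\pi_n\in\mathfrak{S}_n$ are identified with points of $\mathbb{R}^n$; $\mathbf{e}=12\cdots n$. An $Ln1$ permutation is one with $\pi_{n-1}=n$ and $\pi_n=1$. The stack-sorting map $s$: start with an empty stack and read entries left to right; for each entry $x$, while the stack is nonempty and its top $t<x$, pop $t$ to the output; then push $x$. At the end, pop the remaining stack elements to the output; the output is $s(\boldsymbol{\pi})$. $\mathcal{S}^{\boldsymbol{\pi}}=\{\boldsymbol{\pi},s(\boldsymbol{\pi}),s^2(\boldsymbol{\pi}),\dots,\mathbf{e}\}$ (iterating until $\mathbf{e}$ is reached). The relative volume of a lattice polytope $\mathcal{P}$ is its Euclidean volume (in the dimension of its affine span) divided by the Euclidean volume of a fundamental parallelepiped of its affine span, i.e. a parallelepiped generated by a basis of the lattice of integer vectors parallel to the affine span. *)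

(* Defs.v *)
From mathcomp Require Import all_boot all_order all_fingroup all_algebra.
From mathcomp Require Import all_classical all_reals all_analysis.

Set Implicit Arguments.
Unset Strict Implicit.
Unset Printing Implicit Defensive.

Import Order.TTheory GRing.Theory Num.Theory.
Import numFieldNormedType.Exports.

Local Open Scope classical_set_scope.
Local Open Scope ring_scope.

(* One-line notation, with the values 1, ..., n; the entry in position i
   (counted from 1) is [nth 0 w i.-1]. *)
Definition word (n : nat) (p : 'S_n) : seq nat :=
  [seq (p i).+1 | i <- enum 'I_n].

Definition is_Ln1 (n : nat) (p : 'S_n) : Prop :=
  nth 0%N (word p) n.-2 = n /\ nth 0%N (word p) n.-1 = 1%N.

(* A state is (stack, output), with the top of the stack at its head; the
   entries popped by [x] are the longest prefix of the stack below [x]. *)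
Definition stack_step (st : seq nat * seq nat) (x : nat) :=
  let k := find (fun t => ~~ (t < x)%N) st.1 in
  (x :: drop k st.1, st.2 ++ take k st.1).

Definition stack_sort (w : seq nat) : seq nat :=
  let st := foldl stack_step ([::], [::]) w in st.2 ++ st.1.

Definition point (R : realType) (n : nat) (w : seq nat) : 'rV[R]_n :=
  \row_(i < n) (nth 0%N w i)%:R.

(* The iteration stops at the first occurrence of the identity word. *)
Definition stack_orbit (R : realType) (n : nat) (p : 'S_n) : set 'rV[R]_n :=
  [set point R n (iter k stack_sort (word p)) | k in
    [set k | forall j, (j < k)%N -> iter j stack_sort (word p) <> iota 1 n]].
Arguments stack_orbit R {n} p.

Definition conv_hull (R : realType) (n : nat) (A : set 'rV[R]_n) :
    set 'rV[R]_n :=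
  smallest (@convex_set R 'rV[R]_n) A.

Definition affine_span (R : realType) (n : nat) (A : set 'rV[R]_n) :
    set 'rV[R]_n :=
  [set x | exists (m : nat) (c : 'I_m -> R) (a : 'I_m -> 'rV[R]_n),
     [/\ forall i, A (a i), \sum_i c i = 1 & x = \sum_i c i *: a i]].

Definition direction (R : realType) (n : nat) (A : set 'rV[R]_n) :
    set 'rV[R]_n :=
  [set v | exists x y, [/\ affine_span A x, affine_span A y & v = x - y]].

(* Lebesgue measure on R^d, as an iterated product of measures. *)
Fixpoint lebesgue_tuple (R : realType) (d : nat) :
    set (d.-tuple (measurableTypeR R)) -> \bar R :=
  match d with
  | 0%N => dirac [tuple]
  | d'.+1 => pushforward
      (product_measure1 (@lebesgue_measure R) (@lebesgue_tuple R d'))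
      (fun xt => [tuple of xt.1 :: xt.2])
  end.

(* A tuple of d vectors of R^n, with d not fixed in advance; the vectors are
   the rows of the matrix. *)
Definition frame (R : realType) (n : nat) := {d : nat & 'M[R]_(d, n)}.

Definition no_frame (R : realType) (n : nat) : frame R n :=
  Tagged (fun d => 'M[R]_(d, n)) (0 : 'M[R]_(0, n)).

Definition orthonormal_basis (R : realType) (n : nat) (V : set 'rV[R]_n)
    (F : frame R n) : Prop :=
  tagged F *m (tagged F)^T = 1%:M /\ V = [set v | (v <= tagged F)%MS].

(* Euclidean volume of A in the dimension of its affine span: the Lebesgue
   measure of A in the isometric coordinates of this span given by a point of
   A and an orthonormal basis of the direction. The volume does not depend on
   these two choices, which [xget] makes arbitrarily. *)
Definition euclidean_volume (R : realType) (n : nat) (A : set 'rV[R]_n) :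
    \bar R :=
  let F := xget (no_frame R n) [set F | orthonormal_basis (direction A) F] in
  let a := xget 0 A in
  lebesgue_tuple
    [set t | A (a + (\row_(i < tag F) tnth t i) *m tagged F)].

Definition parallel_lattice (R : realType) (n : nat) (A : set 'rV[R]_n) :
    set 'rV[R]_n :=
  [set v | direction A v /\ exists z : 'rV[int]_n, v = map_mx intr z].

Definition lattice_basis (R : realType) (n : nat) (L : set 'rV[R]_n)
    (B : frame R n) : Prop :=
  (forall i, L (row i (tagged B))) /\
  forall v, L v -> exists! c : 'rV[int]_(tag B),
    v = map_mx intr c *m tagged B.

Definition parallelepiped (R : realType) (n : nat) (B : frame R n) :
    set 'rV[R]_n :=
  [set c *m tagged B | c in
    [set c : 'rV[R]_(tag B) | forall i, 0 <= c 0 i <= 1]].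

(* The choice of the lattice basis is again immaterial. *)
Definition relative_volume (R : realType) (n : nat) (A : set 'rV[R]_n) :
    \bar R :=
  let B := xget (no_frame R n) [set B | lattice_basis (parallel_lattice A) B] in
  (euclidean_volume A / euclidean_volume (parallelepiped B))%E.

(* Main.v *)
(* The k-th iterate of an Ln1 word ends in n-k, 1, n-k+1, ..., n. Hence, in the
   basis e_{j+1} - e_1 of the lattice of integer vectors with zero sum, the
   differences between the vertices and the identity form a triangular matrix
   with diagonal -1, ..., -(n-1), and the relative volume of the simplex is
   (n-1)! / (n-1)! = 1.

   Linear maps scale volume by |det|: for E, F measurable and A invertible,
   Fubini and translation invariance give
   vol(EA) vol(F) = vol(FA) vol(-E), so taking for E the unit cube Q,
   vol(FA) = vol(QA) vol(F) and A |-> vol(QA) is multiplicative. It is 1 on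
   permutation matrices and |det| on triangular ones (slice along the first
   coordinate), so it is |det| by the LUP decomposition. *)

From HB Require Import structures.
Require Import Defs.
From mathcomp Require Import all_boot all_order all_fingroup all_algebra.
From mathcomp Require Import all_classical all_reals all_analysis.
From mathcomp Require Import measurable_realfun.

Set Implicit Arguments.
Unset Strict Implicit.
Unset Printing Implicit Defensive.

Import Order.TTheory GRing.Theory Num.Theory.
Import numFieldNormedType.Exports.

Local Open Scope classical_set_scope.
Local Open Scope ring_scope.

(** * Lebesgue measure on R^d *)

(** Both exhaustions are taken nondecreasing, so that a point lying in [F k] and [G l] separately
    lies in the product of index [maxn k l]. *)
Lemma sigma_finite_product_measure1 (R : realType) (d1 d2 : measure_display)
  (T1 : measurableType d1) (T2 : measurableType d2)
  (m1 : {sigma_finite_measure set T1 -> \bar R})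
  (m2 : {sigma_finite_measure set T2 -> \bar R}) :
  sigma_finite setT (product_measure1 m1 m2).
Proof.
have /sigma_finiteP[F [TF ndF Foo]] := sigma_finiteT m1.
have /sigma_finiteP[G [TG ndG Goo]] := sigma_finiteT m2.
exists (fun n => F n `*` G n).
  rewrite -setXTT TF TG; apply/seteqP; split => -[x y] /=.
    move=> [[k _ Fk] [l _ Gl]]; exists (maxn k l) => //; split => /=.
      by move: x Fk; exact/subsetPset/ndF/leq_maxl.
    by move: y Gl; exact/subsetPset/ndG/leq_maxr.
  by move=> [k _ [Fk Gk]]; split; exists k.
move=> k; have [mF Fk] := Foo k; have [mG Gk] := Goo k.
split; first exact: measurableX.
by rewrite product_measure1E// lte_mul_pinfty// ge0_fin_numE.
Qed.

Section Volume.
Variable R : realType.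
Local Notation T := (measurableTypeR R).

(** By uniqueness of Lebesgue measure only half-open intervals matter, and their preimages are
    intervals of the same length. *)
Lemma lebesgue_measure_translate (c : R) (A : set T) : measurable A ->
  pushforward (@lebesgue_measure R) (fun x : T => x + c : T) A = lebesgue_measure A.
Proof.
move=> mA; apply/esym/lebesgue_measure_unique => //=.
  exact: measurable_funD.
move=> mc _ [[a b]] _ <-.
rewrite /pushforward (_ : _ @^-1` _ = `]a - c, b - c]%classic).
  rewrite !lebesgue_measure_itv/= !lte_fin ltrD2r.
  by case: ifP => // _; congr EFin; rewrite opprB addrA subrK.
by apply/seteqP; split => x /=; rewrite !in_itv/= ltrBlDr lerBrDr.
Qed.

Lemma integral_translate (f : T -> \bar R) (c : R) :
  measurable_fun setT f -> (forall x, (0 <= f x)%E) ->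
  (\int[@lebesgue_measure R]_x f (x + c)%R = \int[@lebesgue_measure R]_x f x)%E.
Proof.
move=> mf f0.
have mc : measurable_fun setT (fun x : T => (x + c)%R : T) by exact: measurable_funD.
transitivity (\int[pushforward (@lebesgue_measure R) (fun x : T => (x + c)%R : T)]_x f x)%E.
  by rewrite ge0_integral_pushforward.
pose m := measure_function_pushforward__canonical__measure_function_Measure
  (@lebesgue_measure R) mc.
rewrite -[LHS]/(\int[m]_x f x)%E.
apply: eq_measure_integral => A mA _.
exact: lebesgue_measure_translate.
Qed.

(** Measures live on tuples and matrix algebra on row vectors; [coord] passes from the former to the
    latter. *)
Definition coord d (t : d.-tuple T) : 'rV[R]_d := \row_i tnth t i.

Definition vol d (A : set 'rV[R]_d) : \bar R := @lebesgue_tuple R d (@coord d @^-1` A).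

Lemma coord_cons d (x : R) (t : d.-tuple T) :
  coord [tuple of x :: t] = row_mx x%:M (coord t) :> 'rV_(1 + d).
Proof.
apply/rowP => i; rewrite !mxE.
by case: splitP => j ij; rewrite !mxE (tnth_nth 0) ij /= ?ord1 ?mxE //= (tnth_nth 0).
Qed.

(** Cavalieri's principle: this is the recursion defining [lebesgue_tuple], and the inductions on
    the dimension below slice with it. *)
Lemma vol_recl d (A : set 'rV[R]_(1 + d)) :
  vol A = (\int[@lebesgue_measure R]_x vol [set y : 'rV[R]_d | A (row_mx x%:M y)])%E.
Proof.
rewrite /vol /= /pushforward /product_measure1.
apply: eq_integral => x _ /=; congr lebesgue_tuple.
by apply/seteqP; split => t /=; rewrite /xsection /= inE /= coord_cons.
Qed.

(** The recursive definition yields a bare set function; Tonelli's theorem asks for a sigma-finite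
    measure. Prepending a coordinate is a measurable bijection with measurable inverse, so an
    exhaustion of the product carries over. *)
Lemma lebesgue_tuple_measure d :
  exists m : {sigma_finite_measure set (d.-tuple T) -> \bar R},
    m = @lebesgue_tuple R d :> (set _ -> _).
Proof.
elim: d => [|d [m mE]].
  by exists (dirac ([tuple] : 0.-tuple T)).
pose f (xt : T * d.-tuple T) : d.+1.-tuple T := [tuple of xt.1 :: xt.2].
pose g (t : d.+1.-tuple T) : T * d.-tuple T := (thead t, [tuple of behead t]).
have mf : measurable_fun setT f by exact: measurable_cons.
have mg : measurable_fun setT g.
  by apply: measurable_fun_pair; [exact: measurable_tnth|exact: measurable_behead].
have fK : cancel f g.
  by move=> [x t]; rewrite /f /g /= theadE; congr pair; apply/val_inj.
have gK : cancel g f by move=> t; rewrite /f /g /= [RHS]tuple_eta.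
pose P : {measure set (T * d.-tuple T)%type -> \bar R} :=
  lebesgue_integral_fubini_product_measure1__canonical__measure_function_Measure
    (@lebesgue_measure R) m.
have sf : sigma_finite setT (pushforward P f).
  have [F FT Foo] : sigma_finite setT P by exact: sigma_finite_product_measure1.
  exists (fun n => g @^-1` F n).
    by rewrite -preimage_bigcup -FT preimage_setT.
  move=> n; have [mF Fn] := Foo n; split.
    by rewrite -[X in measurable X]setTI; exact: mg.
  rewrite /pushforward (_ : _ @^-1` _ = F n) //.
  by apply/seteqP; split => x /=; rewrite fK.
have p0 : pushforward P f set0 = 0%E by rewrite /pushforward preimage_set0 measure0.
have pge A : (0 <= pushforward P f A)%E by exact: measure_ge0.
have ps : semi_sigma_additive (pushforward P f).
  exact: (@measure_semi_sigma_additive _ _ _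
    (measure_function_pushforward__canonical__measure_function_Measure P mf)).
pose M : {sigma_finite_measure set (d.+1.-tuple T) -> \bar R} :=
  HB.pack (pushforward P f) (isMeasure.Build _ _ _ (pushforward P f) p0 pge ps)
    (Measure_isSigmaFinite.Build _ _ _ (pushforward P f) sf).
exists (M mf mf mf).
by rewrite /= -mE.
Qed.

Lemma vol0 d : vol (@set0 'rV[R]_d) = 0%E.
Proof.
have [m mE] := lebesgue_tuple_measure d.
by rewrite /vol -mE preimage_set0 measure0.
Qed.

Lemma vol_ge0 d (A : set 'rV[R]_d) : (0 <= vol A)%E.
Proof. by have [m mE] := lebesgue_tuple_measure d; rewrite /vol -mE measure_ge0. Qed.

Lemma integral_step (d : measure_display) (S : measurableType d)
    (m : {measure set S -> \bar R}) (I : set S) (f : S -> \bar R) (c : \bar R) :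
  measurable I -> (0 <= c)%E -> (forall x, I x -> f x = c) ->
  (forall x, ~ I x -> f x = 0%E) -> (\int[m]_x f x = m I * c)%E.
Proof.
move=> mI c0 fI fNI.
rewrite -[RHS]muleC -integral_cst // [RHS]integral_mkcond.
apply: eq_integral => x _; rewrite patchE.
by case: ifPn => [|/negP]; rewrite inE => Ix; [exact: fI|exact: fNI].
Qed.

Lemma vol_sections d (A : set 'rV[R]_(1 + d)) (I : set T) (c : \bar R) :
  measurable I -> (0 <= c)%E ->
  (forall x, I x -> vol [set y | A (row_mx x%:M y)] = c) ->
  (forall x, ~ I x -> vol [set y | A (row_mx x%:M y)] = 0%E) ->
  vol A = (@lebesgue_measure R I * c)%E.
Proof. by move=> mI c0 AI ANI; rewrite vol_recl (integral_step _ mI c0). Qed.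

(** * Measurability for sets of row vectors and for maps into row vectors *)

Definition measurable_rV d (A : set 'rV[R]_d) := measurable (@coord d @^-1` A).

Definition measurable_to_rV (k : measure_display) (S : measurableType k) d (f : S -> 'rV[R]_d) :=
  forall j, measurable_fun setT (fun s => f s 0 j : T).

Lemma measurable_rV_preimage (k : measure_display) (S : measurableType k) d
    (f : S -> 'rV[R]_d) (A : set 'rV[R]_d) :
  measurable_to_rV f -> measurable_rV A -> measurable (f @^-1` A).
Proof.
move=> mf mA.
pose g s : d.-tuple T := [tuple f s 0 i | i < d].
have mg : measurable_fun setT g.
  apply/measurable_fun_tnthP => i.
  by rewrite (_ : _ \o _ = fun s => f s 0 i) //; apply/funext => s /=; rewrite tnth_mktuple.
have -> : f @^-1` A = g @^-1` (@coord d @^-1` A).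
  have fE s : coord (g s) = f s by apply/rowP => i; rewrite mxE tnth_mktuple.
  by apply/seteqP; split => s /=; rewrite fE.
by rewrite -[X in measurable X]setTI; exact: mg.
Qed.

Lemma measurable_to_rV_coord d : measurable_to_rV (@coord d).
Proof.
move=> j; rewrite (_ : (fun _ => _) = (@tnth _ T ^~ j)); first exact: measurable_tnth.
by apply/funext => s; rewrite mxE.
Qed.

Lemma measurable_to_rV_cst (k : measure_display) (S : measurableType k) d (v : 'rV[R]_d) :
  measurable_to_rV (fun _ : S => v).
Proof. by move=> j; exact: measurable_cst. Qed.

Lemma measurable_to_rV_add (k : measure_display) (S : measurableType k) d (f g : S -> 'rV[R]_d) :
  measurable_to_rV f -> measurable_to_rV g -> measurable_to_rV (fun s => f s + g s).
Proof.
move=> mf mg j; rewrite (_ : (fun _ => _) = (fun s => f s 0 j) \+ (fun s => g s 0 j)).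
  by apply: measurable_funD; [exact: mf|exact: mg].
by apply/funext => s; rewrite mxE.
Qed.

Lemma measurable_to_rV_mul (k : measure_display) (S : measurableType k) d e (f : S -> 'rV[R]_d)
    (M : 'M[R]_(d, e)) :
  measurable_to_rV f -> measurable_to_rV (fun s => f s *m M).
Proof.
move=> mf j.
rewrite (_ : (fun _ => _) = (fun s => \sum_(i <- index_enum 'I_d) f s 0 i * M i j)).
  by apply: measurable_sum => i; apply: measurable_funM; [exact: mf|exact: measurable_cst].
by apply/funext => s; rewrite mxE.
Qed.

Lemma measurable_to_rV_opp (k : measure_display) (S : measurableType k) d (f : S -> 'rV[R]_d) :
  measurable_to_rV f -> measurable_to_rV (fun s => - f s).
Proof.
move=> mf; rewrite (_ : (fun _ => _) = fun s => f s *m (- 1%:M)); first exact: measurable_to_rV_mul.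
by apply/funext => s; rewrite mulmxN mulmx1.
Qed.

Lemma measurable_to_rV_row_mx (k : measure_display) (S : measurableType k) d (g : S -> T)
    (f : S -> 'rV[R]_d) :
  measurable_fun setT g -> measurable_to_rV f ->
  measurable_to_rV (fun s => row_mx (g s)%:M (f s) : 'rV[R]_(1 + d)).
Proof.
move=> mg mf j; rewrite -(splitK j); case: (fintype.split j) => i /=.
  rewrite (_ : (fun _ => _) = g) //; apply/funext => s.
  by rewrite row_mxEl !mxE ord1.
by rewrite (_ : (fun _ => _) = (fun s => f s 0 i)) //; apply/funext => s; rewrite row_mxEr.
Qed.

Lemma measurable_rV_comp d e (f : 'rV[R]_d -> 'rV[R]_e) (A : set 'rV[R]_e) :
  measurable_to_rV (fun t => f (@coord d t)) -> measurable_rV A -> measurable_rV (f @^-1` A).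
Proof. by move=> mf mA; exact: (measurable_rV_preimage mf mA). Qed.

Lemma measurable_vol_section d (A : set 'rV[R]_(1 + d)) : measurable_rV A ->
  measurable_fun setT (fun x : T => vol [set y | A (row_mx x%:M y)]).
Proof.
move=> mA; have [m mE] := lebesgue_tuple_measure d.
pose B := [set xt : T * d.-tuple T | A (row_mx (xt.1)%:M (coord xt.2))].
have mB : measurable B.
    apply: (measurable_rV_preimage (f := fun xt : T * d.-tuple T => row_mx (xt.1)%:M (coord xt.2))) mA.
  apply: measurable_to_rV_row_mx => [|j]; first exact: measurable_fst.
  by apply: (@measurableT_comp _ _ _ _ _ _ (fun t => coord t 0 j)) => //; exact: measurable_to_rV_coord.
have := measurable_fun_xsection m mB.
rewrite (_ : _ \o _ = fun x => vol [set y | A (row_mx x%:M y)]) //.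
apply/funext => x /=; rewrite mE; congr lebesgue_tuple.
by apply/seteqP; split => t /=; rewrite /xsection /= inE.
Qed.

Lemma measurable_rV_section d (x : R) (A : set 'rV[R]_(1 + d)) :
  measurable_rV A -> measurable_rV [set y : 'rV[R]_d | A (row_mx x%:M y)].
Proof.
apply: (@measurable_rV_comp d (1 + d) (fun y => row_mx x%:M y)).
by apply: measurable_to_rV_row_mx; [exact: measurable_cst|exact: measurable_to_rV_coord].
Qed.

(** Induction on the dimension: the first coordinate of [v] shifts the variable of the outer
    integral, and the other coordinates translate each slice. *)
Lemma vol_translate d (v : 'rV[R]_d) (A : set 'rV[R]_d) :
  measurable_rV A -> vol [set x | A (x + v)] = vol A.
Proof.
elim: d => [|d IHd] in v A *; first by rewrite (thinmx0 v); under eq_set do rewrite addr0.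
rewrite -[d.+1]/(1 + d)%N in v A * => mA.
pose v1 := lsubmx v 0 0.
rewrite [LHS]vol_recl [RHS]vol_recl -[RHS](@integral_translate _ v1); first last.
- by move=> x; exact: vol_ge0.
- exact: (measurable_vol_section mA).
apply: eq_integral => x _.
rewrite -[RHS](IHd (rsubmx v)); last exact: (measurable_rV_section _ mA).
have vE y : row_mx x%:M y + v = row_mx (x + v1)%:M (y + rsubmx v).
  rewrite -[v in LHS]hsubmxK add_row_mx; congr row_mx.
  by rewrite [lsubmx v]mx11_scalar -raddfD.
by congr vol; apply/seteqP; split => y /=; rewrite vE.
Qed.

(** The offset [a] is free because both the unit cube and its reflection through the origin are
    needed. *)
Lemma vol_unit_box d (a : R) : vol [set x : 'rV[R]_d | forall i, a <= x 0 i <= a + 1] = 1%E.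
Proof.
elim: d => [|d IHd].
  by rewrite /vol /= diracE mem_set //=; case.
rewrite -[d.+1]/(1 + d)%N (@vol_sections d _ `[a, a + 1]%classic 1%E) //.
- rewrite lebesgue_measure_itv /= lte_fin ltrDl ltr01 mule1 -EFinB.
  by congr EFin; rewrite addrAC subrr add0r.
- move=> x /=; rewrite in_itv /= => ax; rewrite -[RHS]IHd; congr vol.
  apply/seteqP; split => y /= H i.
    by have := H (rshift 1 i); rewrite row_mxEr.
  by rewrite -(splitK i); case: fintype.split => j /=;
      rewrite ?row_mxEl ?row_mxEr ?mxE ?ord1.
- move=> x /= ax; rewrite (_ : mkset _ = set0) ?vol0 // -subset0 => y /= /(_ (lshift d 0)).
  by rewrite row_mxEl !mxE /= => H; apply: ax; rewrite in_itv.
Qed.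

(** Tonelli's theorem for the indicator function of the region [G]. *)
Lemma vol_exchange d (m : {sigma_finite_measure set (d.-tuple T) -> \bar R})
    (G : 'rV[R]_d -> 'rV[R]_d -> Prop) :
  m = @lebesgue_tuple R d :> (set _ -> _) ->
  measurable [set st : d.-tuple T * d.-tuple T | G (coord st.1) (coord st.2)] ->
  (\int[m]_s vol [set y | G (coord s) y] = \int[m]_t vol [set x | G x (coord t)])%E.
Proof.
move=> mE mG.
have := indic_fubini_tonelli m m mG.
rewrite indic_fubini_tonelli_FE // indic_fubini_tonelli_GE //.
set f := (X in (\int[m]_x X x)%E = _ -> _); set g := (X in _ = (\int[m]_x X x)%E -> _).
move=> fg; transitivity (\int[m]_x f x)%E; last rewrite fg.
  apply: eq_integral => s _; rewrite /f /= mE; congr lebesgue_tuple.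
  by apply/seteqP; split => t /=; rewrite /xsection /= inE.
apply: eq_integral => s _; rewrite /g /= mE; congr lebesgue_tuple.
by apply/seteqP; split => t /=; rewrite /ysection /= inE.
Qed.

(* Both sides are the volume of {(x, y) | E (x N) and F (y + x N)}, up to the
   translation of x by - y M in each slice. *)
Lemma vol_linear_ratio d (M N : 'M[R]_d) (E F : set 'rV[R]_d) :
  M *m N = 1%:M -> measurable_rV E -> measurable_rV F ->
  (vol [set x | E (x *m N)%R] * vol F = vol [set x | F (x *m N)%R] * vol [set x | E (- x)%R])%E.
Proof.
move=> MN mE mF.
have [m mu] := lebesgue_tuple_measure d.
have mc1 : measurable_to_rV (fun st : d.-tuple T * d.-tuple T => coord st.1 *m N).
  apply: measurable_to_rV_mul => j; apply: (@measurableT_comp _ _ _ _ _ _ (fun t => coord t 0 j)) => //.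
  exact: measurable_to_rV_coord.
have mc2 : measurable_to_rV (fun st : d.-tuple T * d.-tuple T => coord st.2).
  move=> j; apply: (@measurableT_comp _ _ _ _ _ _ (fun t => coord t 0 j)) => //.
  exact: measurable_to_rV_coord.
have mN (A : set 'rV[R]_d) : measurable_rV A -> measurable_rV [set x | A (x *m N)].
  by apply: (@measurable_rV_comp _ _ (fun x => x *m N)); apply: measurable_to_rV_mul; exact: measurable_to_rV_coord.
pose G x y := E (x *m N) /\ F (y + x *m N).
pose G' x y := E (x *m N - y) /\ F (x *m N).
have mG : measurable [set st : d.-tuple T * d.-tuple T | G (coord st.1) (coord st.2)].
  apply: measurableI; first exact: (measurable_rV_preimage mc1 mE).
  exact: (measurable_rV_preimage (measurable_to_rV_add mc2 mc1) mF).
have mG' : measurable [set st : d.-tuple T * d.-tuple T | G' (coord st.1) (coord st.2)].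
  apply: measurableI; last exact: (measurable_rV_preimage mc1 mF).
  exact: (measurable_rV_preimage (measurable_to_rV_add mc1 (measurable_to_rV_opp mc2)) mE).
transitivity (\int[m]_s vol [set y | G (coord s) y])%E.
  rewrite (@integral_step _ _ m (@coord d @^-1` [set x | E (x *m N)]) _ (vol F)) //.
  - by rewrite /vol -mu.
  - exact: mN.
  - exact: vol_ge0.
  - move=> s /= Es; rewrite -[RHS](vol_translate (coord s *m N) mF); congr vol.
    by apply/seteqP; split => y //= [].
  - by move=> s /= Es; rewrite (_ : mkset _ = set0) ?vol0 // -subset0 => y [].
rewrite (vol_exchange mu mG).
transitivity (\int[m]_t vol [set x | G' x (coord t)])%E.
  apply: eq_integral => t _.
  have mGt : measurable_rV [set x | G x (coord t)].
    apply: measurableI; first exact: mN.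
    apply: (measurable_rV_preimage (f := fun s => coord t + coord s *m N)) mF.
    by apply: measurable_to_rV_add; [exact: measurable_to_rV_cst|];
    apply: measurable_to_rV_mul; exact: measurable_to_rV_coord.
  rewrite -[LHS](vol_translate (- (coord t *m M)) mGt); congr vol.
  by apply/seteqP; split => x /=; rewrite /G /G' mulmxBl -mulmxA MN mulmx1 (addrC (coord t)) subrK.
rewrite -(vol_exchange mu mG').
rewrite (@integral_step _ _ m (@coord d @^-1` [set x | F (x *m N)]) _ (vol [set x | E (- x)])) //.
- by rewrite /vol -mu.
- exact: mN.
- exact: vol_ge0.
- move=> s /= Fs.
  have mEs : measurable_rV [set y | E (coord s *m N - y)].
    apply: (measurable_rV_preimage (f := fun t => coord s *m N - coord t)) mE.
    by apply: measurable_to_rV_add; [exact: measurable_to_rV_cst|];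
    apply: measurable_to_rV_opp; exact: measurable_to_rV_coord.
  rewrite (_ : mkset _ = [set y | E (coord s *m N - y)]).
    rewrite -(vol_translate (coord s *m N) mEs); congr vol.
    by apply/seteqP; split => y /=; rewrite opprD addrCA subrr addr0.
  by apply/seteqP; split => y //= [].
- by move=> s /= Fs; rewrite (_ : mkset _ = set0) ?vol0 // -subset0 => y [].
Qed.

End Volume.

(** * Linear images *)

Section Determinant.
Variable R : realType.
Local Notation T := (measurableTypeR R).

Definition cube d : set 'rV[R]_d := [set x | forall i, 0 <= x 0 i <= 1].

Lemma vol_cube d : vol (@cube d) = 1%E.
Proof. by rewrite -(vol_unit_box d 0); congr vol; rewrite /cube add0r. Qed.

(** Closed half-spaces: the cube and the simplex below are finite intersections of these. *)
Lemma measurable_rV_half d (w : 'cV[R]_d) (a : R) : measurable_rV [set x | a <= (x *m w) 0 0].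
Proof.
have mw : measurable_fun setT (fun t : d.-tuple T => (coord t *m w) 0 0 : T).
  by apply: measurable_to_rV_mul; exact: measurable_to_rV_coord.
have := mw measurableT _ (measurable_itv `[a, +oo[); rewrite setTI.
congr measurable; apply/seteqP; split => t /=; by rewrite in_itv /= andbT.
Qed.

Lemma measurable_rV_forall d (I : finType) (A : I -> set 'rV[R]_d) :
  (forall i, measurable_rV (A i)) -> measurable_rV [set x | forall i, A i x].
Proof.
move=> mA; have : measurable (\bigcap_(i in [set: I]) (@coord R d @^-1` A i)).
  by apply: fin_bigcap_measurable => [|i _]; [exact: finite_finset|exact: mA].
congr measurable; apply/seteqP; split => t /= H; last by move=> i _; exact: H.
by move=> i; exact: H.
Qed.

Lemma measurable_rV_cube d : measurable_rV (@cube d).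
Proof.
have -> : @cube d = [set x | forall i : 'I_d, [set x | 0 <= (x *m delta_mx i (0 : 'I_1)) 0 0] x /\
    [set x | -1 <= (x *m (- delta_mx i (0 : 'I_1))) 0 0] x].
  apply/seteqP; split => x /= H i; have := H i; rewrite mulmxN -colE !mxE lerN2.
    by move/andP.
  by move=> [-> ->].
by apply: measurable_rV_forall => i; apply: measurableI; exact: measurable_rV_half.
Qed.

(** The standard simplex dilated by [r]. With the size as a parameter, its slices are again of this
    form. *)
Definition corner d (r : R) : set 'rV[R]_d :=
  [set x | (forall i, 0 <= x 0 i) /\ \sum_i x 0 i <= r].

Lemma measurable_rV_corner d (r : R) : measurable_rV (@corner d r).
Proof.
have -> : @corner d r = [set x | forall i : 'I_d, [set x | 0 <= (x *m delta_mx i (0 : 'I_1)) 0 0] x]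
    `&` [set x | - r <= (x *m (- const_mx 1 : 'cV_d)) 0 0].
  have sE (x : 'rV[R]_d) : (x *m (- const_mx 1 : 'cV_d)) 0 0 = - \sum_i x 0 i.
    by rewrite mulmxN !mxE; congr (- _); apply: eq_bigr => i _; rewrite mxE mulr1.
  apply/seteqP; split => x /= [H1 H2]; split.
  - by move=> i; rewrite -colE mxE.
  - by rewrite sE lerN2.
  - by move=> i; have := H1 i; rewrite -colE mxE.
  - by move: H2; rewrite sE lerN2.
by apply: measurableI; [apply: (@measurable_rV_forall d 'I_d) => i|]; exact: measurable_rV_half.
Qed.

Definition image_mx d e (M : 'M[R]_(d, e)) (A : set 'rV[R]_d) : set 'rV[R]_e :=
  [set x *m M | x in A].

Lemma image_mxE d (M : 'M[R]_d) (A : set 'rV[R]_d) : M \in unitmx ->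
  image_mx M A = [set x | A (x *m invmx M)].
Proof.
move=> uM; apply/seteqP; split => [_ [x Ax <-]|x Ax] /=; first by rewrite mulmxK.
by exists (x *m invmx M) => //; rewrite mulmxKV.
Qed.

Lemma measurable_rV_image d (M : 'M[R]_d) (A : set 'rV[R]_d) : M \in unitmx -> measurable_rV A ->
  measurable_rV (image_mx M A).
Proof.
move=> uM mA; rewrite image_mxE //; apply: (@measurable_rV_comp _ _ _ (fun x => x *m invmx M)) mA.
by apply: measurable_to_rV_mul; exact: measurable_to_rV_coord.
Qed.

Lemma vol_image_cube d (M : 'M[R]_d) (A : set 'rV[R]_d) : M \in unitmx -> measurable_rV A ->
  vol (image_mx M A) = (vol (image_mx M (@cube d)) * vol A)%E.
Proof.
move=> uM mA; rewrite !image_mxE //.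
rewrite (@vol_linear_ratio _ _ M) //; [|exact: mulmxV|exact: measurable_rV_cube].
rewrite (_ : vol [set x | cube (- x)] = 1%E) ?mule1 //.
(* The reflected cube is the unit box whose least corner has all coordinates -1. *)
rewrite -(vol_unit_box d (-1)); congr vol.
apply/seteqP; split => x /= H i; have := H i;
  by rewrite mxE addNr oppr_ge0 lerNl andbC.
Qed.

Lemma vol_image_cube_mul d (M N : 'M[R]_d) : M \in unitmx -> N \in unitmx ->
  vol (image_mx (M *m N) (@cube d)) =
  (vol (image_mx N (@cube d)) * vol (image_mx M (@cube d)))%E.
Proof.
move=> uM uN; rewrite -[RHS]vol_image_cube //; last exact: measurable_rV_image (@measurable_rV_cube d).
congr vol; apply/seteqP; split => [_ [x cx <-]|_ [_ [x cx <-] <-]].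
  by exists (x *m M); rewrite ?mulmxA //; exists x.
by exists x => //; rewrite mulmxA.
Qed.

(** Permuting the coordinates maps the cube onto itself. *)
Lemma vol_image_cube_perm d (s : 'S_d) : vol (image_mx (perm_mx s) (@cube d)) = 1%E.
Proof.
rewrite -(vol_cube d) image_mxE ?unitmx_perm //; congr vol.
have sE (x : 'rV[R]_d) i : (x *m invmx (perm_mx s)) 0 i = x 0 (s i).
  have -> : invmx (perm_mx s) = perm_mx (s^-1)%g :> 'M[R]_d.
    apply: (can_inj (mulKmx (unitmx_perm R s))).
    by rewrite mulmxV ?unitmx_perm // -perm_mxM mulgV perm_mx1.
  by rewrite -col_permE mxE.
apply/seteqP; split => x /= H i; last by rewrite sE.
by have := H ((s^-1)%g i); rewrite sE permKV.
Qed.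

Lemma lebesgue_measure_div_itv (t : R) : t != 0 ->
  @lebesgue_measure R [set y | 0 <= y / t <= 1] = `|t|%:E.
Proof.
move=> t0; have [t_gt0|t_lt0|/eqP] := ltgtP t 0; last by rewrite (negPf t0).
- rewrite (_ : mkset _ = `[t, 0]%classic).
    by rewrite lebesgue_measure_itv /= lte_fin t_gt0 add0e ltr0_norm.
  apply/seteqP; split => y /=; rewrite in_itv /= ler_ndivrMr // mul1r;
    by rewrite nmulr_lge0 ?invr_lt0 // andbC.
- rewrite (_ : mkset _ = `[0, t]%classic).
    by rewrite lebesgue_measure_itv /= lte_fin t_lt0 -EFinB subr0 gtr0_norm.
  apply/seteqP; split => y /=; rewrite in_itv /= ler_pdivrMr // mul1r;
    by rewrite pmulr_lge0 ?invr_gt0.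
Qed.

Lemma measurable_div_itv (t : R) : measurable ([set y | 0 <= y / t <= 1] : set T).
Proof.
have mt : measurable_fun setT (fun y : T => y / t : T).
  by apply: measurable_funM => //; exact: measurable_cst.
have := mt measurableT _ (measurable_itv `[0, 1]); rewrite setTI.
by congr measurable; apply/seteqP; split => y /=; rewrite in_itv.
Qed.

(** Write [M] in blocks with first row [(t, r)] and lower right block [M']. The slice of the image
    at first coordinate [y] is empty unless [y / t] lies in [0, 1], and is then a translate of the
    image of the smaller cube under [M']. Hence the volume is [|t|] times that of the latter. *)
Lemma vol_image_cube_upper d (M : 'M[R]_d) : (forall i j : 'I_d, (j < i)%N -> M i j = 0) ->
  M \in unitmx -> vol (image_mx M (@cube d)) = `|\det M|%:E.
Proof.
elim: d => [|d IHd] in M *.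
  move=> _ _; rewrite det_mx00 normr1 -(vol_cube 0); congr vol.
  apply/seteqP; split => x _; first by case.
  by exists 0; [case|rewrite mul0mx [RHS]thinmx0].
rewrite -[d.+1]/(1 + d)%N in M * => Mup uM.
pose t := M 0 0; pose r := ursubmx M; pose M' := drsubmx M.
have ME : M = block_mx t%:M r 0 M'.
  rewrite -[M in LHS]submxK; congr block_mx.
    by rewrite [ulsubmx M]mx11_scalar !mxE; congr (M _ _)%:M; apply/val_inj.
  by apply/matrixP => i j; rewrite !mxE ord1; apply: Mup.
have detM : \det M = t * \det M' by rewrite ME det_ublock det_scalar1.
have [t0 d0] : t != 0 /\ \det M' != 0.
  by move: uM; rewrite unitmxE unitfE detM mulf_eq0 negb_or => /andP.
have uM' : M' \in unitmx by rewrite unitmxE unitfE.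
have mI := measurable_rV_image uM' (@measurable_rV_cube d).
(* A row [(x1, x2)] is sent to [(x1 t, x1 r + x2 M')], so [y] determines [x1 = y / t] and the slice
   is shifted by [(y / t) r]. *)
have imE (y : R) (z : 'rV[R]_d) : image_mx M (@cube (1 + d)) (row_mx y%:M z) <->
    0 <= y / t <= 1 /\ image_mx M' (@cube d) (z + - (y / t) *: r).
  split.
    case=> x cx; rewrite -(hsubmxK x) ME mul_row_block mulmx0 addr0 => /eq_row_mx [].
    set x1 := lsubmx x; set x2 := rsubmx x.
    have x1E : x1 = (x1 0 0)%:M by exact: mx11_scalar.
    rewrite x1E -scalar_mxM => /[swap] zE /(congr1 (fun m : 'M[R]_1 => m 0 0)); rewrite !mxE !mulr1n => yE.
    have ytE : y / t = x1 0 0 by rewrite [RHS]mxE -yE mulfK.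
    split; first by rewrite ytE mxE; exact: cx.
    exists x2; first by move=> i; rewrite mxE; exact: cx.
    by rewrite ytE -zE mul_scalar_mx scaleNr addrAC subrr add0r.
  move=> [yt [x cx xE]]; exists (row_mx (y / t)%:M x).
    by move=> i; rewrite -(splitK i); case: fintype.split => j /=;
      rewrite ?row_mxEl ?row_mxEr ?mxE ?ord1.
  rewrite ME mul_row_block mulmx0 addr0 -scalar_mxM divfK // mul_scalar_mx xE.
  by rewrite addrCA scaleNr subrr addr0.
rewrite (@vol_sections _ d _ [set y | 0 <= y / t <= 1] `|\det M'|%:E).
- by rewrite lebesgue_measure_div_itv // -EFinM detM normrM.
- exact: measurable_div_itv.
- by rewrite lee_fin.
- move=> y /= yt; rewrite -(IHd M') //; last first.
    by move=> i j ij; rewrite !mxE; apply: Mup; rewrite /= ltn_add2l.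
  rewrite -(vol_translate (- (y / t) *: r) mI); congr vol.
  by apply/seteqP; split => z /= => [/imE []|] // H; apply/imE.
- move=> y /= yt; rewrite (_ : mkset _ = set0) ?vol0 // -subset0 => z /= /imE [].
  by [].
Qed.

Lemma norm_det_perm d (s : 'S_d) : `|\det (perm_mx s : 'M[R]_d)| = 1.
Proof. by rewrite det_perm normrX normrN1 expr1n. Qed.

(** Conjugation by the permutation reversing the coordinates makes [M] upper triangular, and changes
    neither the volume nor the absolute value of the determinant. *)
Lemma vol_image_cube_lower d (M : 'M[R]_d) : (forall i j : 'I_d, (i < j)%N -> M i j = 0) ->
  M \in unitmx -> vol (image_mx M (@cube d)) = `|\det M|%:E.
Proof.
move=> Mlow uM; pose s : 'S_d := perm (can_inj (@rev_ordK d)).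
pose N := perm_mx s *m M *m perm_mx (s^-1)%g.
have NE i j : N i j = M (rev_ord i) (rev_ord j).
  by rewrite /N -col_permE -row_permE !mxE !permE.
have uN : N \in unitmx by rewrite !unitmx_mul !unitmx_perm uM.
have := @vol_image_cube_upper _ N _ uN.
rewrite /N vol_image_cube_mul ?unitmx_mul ?unitmx_perm // vol_image_cube_perm mul1e.
rewrite vol_image_cube_mul ?unitmx_perm // vol_image_cube_perm mule1.
rewrite !det_mulmx !normrM !norm_det_perm mulr1 mul1r; apply.
move=> i j ij; rewrite NE; apply: Mlow => /=.
by rewrite ltn_sub2l // (leq_ltn_trans _ (ltn_ord i)).
Qed.

Lemma vol_image d (M : 'M[R]_d) (A : set 'rV[R]_d) : M \in unitmx -> measurable_rV A ->
  vol (image_mx M A) = (`|\det M|%:E * vol A)%E.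
Proof.
move=> uM mA; rewrite vol_image_cube //; congr (_ * _)%E.
(* In dimension zero every matrix is triangular; in positive dimension the decomposition [P M = L U]
   is used. *)
case: d => [|d] in M A uM mA *.
  by apply: vol_image_cube_upper => // - [].
have := cormen_lup_perm M; have := cormen_lup_correct M; have := cormen_lup_detL M.
have := @cormen_lup_lower _ _ M; have := @cormen_lup_upper _ _ M.
case: (cormen_lup M) => [[P L] U] /= Uup Llow detL PM /is_perm_mxP [s PE].
have uL : L \in unitmx by rewrite unitmxE detL unitr1.
have uPM : P *m M \in unitmx by rewrite unitmx_mul PE unitmx_perm.
have uU : U \in unitmx by move: uPM; rewrite -[P *m M]/(P * M) PM unitmx_mul uL.
(* The image of the cube under [L U = P M] is measured through both factorisations; [P] contributes
   the factor 1. *)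
have := vol_image_cube_mul uL uU; rewrite -[L *m U]/(L * U) -PM PE.
rewrite vol_image_cube_mul ?unitmx_perm // vol_image_cube_perm mule1 => ->.
rewrite vol_image_cube_upper // vol_image_cube_lower //; last first.
  by move=> i j ij; rewrite Llow ?(ltnW ij) // -val_eqE /= ltn_eqF.
rewrite -EFinM -normrM mulrC -det_mulmx -[L *m U]/(L * U) -PM PE.
by rewrite [in LHS]det_mulmx normrM norm_det_perm mul1r.
Qed.

(** The slice at first coordinate [x] is the simplex of size [r - x], so the volume is the integral
    of [(r - x)^d / d!] over [0, r]. *)
Lemma vol_corner d (r : R) : 0 <= r -> vol (@corner d r) = (r ^+ d / d`!%:R)%:E.
Proof.
elim: d => [|d IHd] in r *.
  move=> r0; rewrite expr0 fact0 divr1 -(vol_cube 0); congr vol.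
  by apply/seteqP; split => x _; [case|split => [[]|] //; rewrite big_ord0].
rewrite -[d.+1]/(1 + d)%N => r0.
have cE (x : R) (y : 'rV[R]_d) :
    @corner (1 + d) r (row_mx x%:M y) <-> 0 <= x /\ @corner d (r - x) y.
  have -> : @corner (1 + d) r (row_mx x%:M y) <->
      (forall i : 'I_(1 + d), 0 <= (row_mx x%:M y : 'rV_(1 + d)) 0 i) /\ x + \sum_i y 0 i <= r.
    rewrite /corner /= big_split_ord /= big_ord1 row_mxEl mxE /=.
    by under eq_bigr do rewrite row_mxEr.
  rewrite /corner /= lerBrDl; split => [[H s]|[x0 [H s]]]; split => //.
  - by have := H (lshift d 0); rewrite row_mxEl mxE.
  - by split => // i; have := H (rshift 1 i); rewrite row_mxEr.
  - by move=> i; rewrite -(splitK i); case: fintype.split => j /=;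
      rewrite ?row_mxEl ?row_mxEr ?mxE ?ord1.
have sum_ge0 (y : 'rV[R]_d) : (forall i, 0 <= y 0 i) -> 0 <= \sum_i y 0 i.
  by move=> y0; apply: sumr_ge0 => i _.
rewrite vol_recl.
transitivity (\int[@lebesgue_measure R]_(x in `[0%R, r]) ((r - x) ^+ d / d`!%:R)%:E)%E.
  rewrite [RHS]integral_mkcond; apply: eq_integral => x _; rewrite patchE.
  case: ifPn => [|/negP]; rewrite inE /= in_itv /=.
    move=> /andP [x0 xr]; rewrite -IHd ?subr_ge0 //; congr vol.
    by apply/seteqP; split => y /= => [/cE []|H] //; apply/cE.
  move=> xr; rewrite (_ : mkset _ = set0) ?vol0 // -subset0 => y /= /cE [x0 [y0 s]].
  by apply: xr; rewrite x0 -subr_ge0 (le_trans (sum_ge0 _ y0)).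
(* For [r = 0] the interval of integration is a point; otherwise the integral is evaluated with the
   antiderivative [F]. *)
move: r0; rewrite le_eqVlt => /orP [/eqP <-|r0].
  by rewrite set_itv1 integral_set1 expr0n mul0r.
pose F (x : R) := - ((r - x) ^+ d.+1 / (d.+1)`!%:R).
have dF (x : R) : is_derive x 1 F ((r - x) ^+ d / d`!%:R).
  have -> : F = (- (d.+1)`!%:R^-1) *: ((cst r - id : R -> R) ^+ d.+1).
    by apply/funext => y; rewrite /F !fctE mulrC -mulNr.
  apply: is_derive_eq; rewrite add0r !fctE /GRing.scale /= mulrN1 mulrNN factS natrM.
  by rewrite invfM -mulrA mulrCA mulKf ?pnatr_eq0 // mulrC.
have cF : continuous F.
  move=> x; apply: differentiable_continuous; apply/derivable1_diffP.
  by have [] := dF x.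
rewrite (@continuous_FTC2 _ _ F) //.
- by rewrite /F subrr subr0 expr0n mul0r oppr0 -EFinB opprK add0r.
- apply: continuous_subspaceT => x.
  apply: (@continuousM R R (fun x => (r - x) ^+ d) (cst (d`!%:R^-1))); last exact: cst_continuous.
  apply: (@continuous_comp _ _ _ (fun x : R => r - x) (fun y : R => y ^+ d));
    last exact: exprn_continuous.
  by apply: continuousB => //; exact: cst_continuous.
- split.
  + by move=> x _; have [] := dF x.
  + exact: cvg_at_right_filter (cF 0).
  + exact: cvg_at_left_filter (cF r).
- by move=> x _; rewrite derive1E; have [_ ->] := dF x.
Qed.
End Determinant.

(** * Simplices and parallelepipeds *)

Section Geometry.
Variable R : realType.

(** With [D] the simplex [corner 1] this is the simplex with vertices [a] and [a + row i W]; with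
    [D] the cube it is the parallelepiped at [a] spanned by the rows of [W]. *)
Definition param d n (a : 'rV[R]_n) (W : 'M[R]_(d, n)) (D : set 'rV[R]_d) : set 'rV[R]_n :=
  [set a + x *m W | x in D].

Lemma affine_span_param d n (a : 'rV[R]_n) (W : 'M[R]_(d, n)) (D : set 'rV[R]_d) x :
  affine_span (param a W D) x -> (x - a <= W)%MS.
Proof.
move=> [m [c [p [Sp c1 ->]]]].
rewrite -[a in X in (_ - X <= _)%MS]scale1r -c1 scaler_suml -sumrB summx_sub // => i _.
rewrite -scalerBr scalemx_sub //; have [z _ <-] := Sp i.
by rewrite addrAC subrr add0r submxMl.
Qed.

Lemma direction_param d n (a : 'rV[R]_n) (W : 'M[R]_(d, n)) (D : set 'rV[R]_d) :
  D 0 -> (forall i, D (delta_mx 0 i)) ->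
  direction (param a W D) = [set v | (v <= W)%MS].
Proof.
move=> D0 D1; apply/seteqP; split => v /=.
  move=> [x [y [/affine_span_param xW /affine_span_param yW ->]]].
  have -> : x - y = (x - a) - (y - a) by rewrite opprB addrA subrK.
  by rewrite addmx_sub // eqmx_opp.
case/submxP => z ->; exists (a + z *m W), a; split; last by rewrite addrAC subrr add0r.
  (* The point [a + z W] is the affine combination of [a] with weight [1 - \sum_j z 0 j] and of the
     points [a + row j W] with weights [z 0 j]. *)
  exists d.+1, (fun i => if unlift ord0 i is Some j then z 0 j else 1 - \sum_j z 0 j),
    (fun i => if unlift ord0 i is Some j then a + row j W else a); split.
  - move=> i; case: unliftP => [j _|_]; last by exists 0; rewrite ?mul0mx ?addr0.
    by exists (delta_mx 0 j); rewrite // -rowE.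
  - rewrite big_ord_recl unlift_none; under [X in _ + X]eq_bigr do rewrite liftK.
    by rewrite subrK.
  - rewrite big_ord_recl unlift_none; under [X in _ = _ + X]eq_bigr do rewrite liftK scalerDr.
    rewrite big_split /= -scaler_suml scalerBl scale1r addrA subrK; congr (_ + _).
    by rewrite mulmx_sum_row.
exists 1%N, (fun=> 1), (fun=> a); split => [_||]; rewrite ?big_ord1 ?scale1r //.
by exists 0; rewrite ?mul0mx ?addr0.
Qed.

(** [F^T *m F] is the orthogonal projection onto the row space of [F], which contains the rows of
    [W]. *)
Lemma mulmx_orthonormalK d n (F W : 'M[R]_(d, n)) :
  F *m F^T = 1%:M -> (W <= F)%MS -> W *m F^T *m F = W.
Proof. by move=> FF /submxP [Z ->]; rewrite -!mulmxA (mulmxA F) FF mul1mx. Qed.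

(** [W *m F^T] holds the coordinates of the rows of [W] in the frame [F]. Multiplying it by [F]
    gives back [W], so its rank is full. *)
Lemma unitmx_mul_orthonormal d n (F W : 'M[R]_(d, n)) :
  F *m F^T = 1%:M -> (W <= F)%MS -> row_free W -> W *m F^T \in unitmx.
Proof.
move=> FF WF Wfree; rewrite -row_free_unit /row_free eqn_leq rank_leq_row /=.
by rewrite -[X in (X <= _)%N](eqP Wfree) -{1}(mulmx_orthonormalK FF WF) mxrankM_maxl.
Qed.

(** In the coordinates given by [b] and [F] the set is a translate of the image of [D] under
    [W *m F^T]; the choice of [b] affects only the translation. *)
Lemma vol_param d n (F W : 'M[R]_(d, n)) (a b : 'rV[R]_n) (D : set 'rV[R]_d) :
  F *m F^T = 1%:M -> (W <= F)%MS -> row_free W -> measurable_rV D -> param a W D b ->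
  vol [set y | param a W D (b + y *m F)] = (`|\det (W *m F^T)|%:E * vol D)%E.
Proof.
move=> FF WF Wfree mD [x0 _ <-].
have WE := mulmx_orthonormalK FF WF.
have uWF := unitmx_mul_orthonormal FF WF Wfree.
rewrite -vol_image // -[RHS](vol_translate (x0 *m (W *m F^T))); last exact: measurable_rV_image.
congr vol; apply/seteqP; split => y /=.
  case=> x Dx; rewrite -addrA => /addrI /(congr1 (fun v => v *m F^T)).
  rewrite mulmxDl -!mulmxA FF mulmx1 => xE; exists x => //.
  by rewrite xE addrC.
case=> x Dx xE; exists x => //; rewrite -addrA; congr (_ + _).
have -> : x *m W = x *m (W *m F^T) *m F by rewrite -mulmxA WE.
by rewrite xE mulmxDl addrC -mulmxA WE.
Qed.

Lemma row_mul_tr_gt0 n (u : 'rV[R]_n) : u != 0 -> 0 < (u *m u^T) 0 0.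
Proof.
move=> u0; have uE : (u *m u^T) 0 0 = \sum_i u 0 i ^+ 2.
  by rewrite mxE; apply: eq_bigr => i _; rewrite mxE.
rewrite uE lt_neqAle sumr_ge0 ?andbT => [|i _]; last exact: sqr_ge0.
apply: contra u0; rewrite eq_sym psumr_eq0 => [/allP H|i _]; last exact: sqr_ge0.
apply/eqP/rowP => i; rewrite mxE.
by have := H i (mem_index_enum i); rewrite sqrf_eq0 => /eqP.
Qed.

Lemma gram_schmidt d n (W : 'M[R]_(d, n)) : row_free W ->
  exists2 F : 'M[R]_(d, n), F *m F^T = 1%:M & (F :=: W)%MS.
Proof.
elim: d => [|d IHd] in W *.
  by exists W => //; rewrite [LHS]flatmx0 [RHS]flatmx0.
rewrite -[d.+1]/(1 + d)%N in W * => Wfree.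
pose w := usubmx W; pose W' := dsubmx W.
have rW : \rank (w + W')%MS = (1 + d)%N.
  by rewrite addsmxE vsubmxK; exact/eqP.
have W'free : row_free W'.
  rewrite /row_free eqn_leq rank_leq_row /= -(leq_add2l 1) -rW.
  by rewrite (leq_trans (mxrank_adds_leqif _ _)) // leq_add2r rank_leq_row.
have [F FF FW] := IHd _ W'free.
have wNF : ~~ (w <= F)%MS.
  apply/negP; rewrite FW => wW'; have := rW.
  by rewrite (addsmx_idPr wW') => rW'; have := rank_leq_row W'; rewrite rW' ltnn.
(* The component of the first row orthogonal to the frame of the other rows. It is nonzero because
   [w] is outside their span, so it can be normalised. *)
pose u := w - w *m F^T *m F.
have uF : u *m F^T = 0 by rewrite mulmxBl -!mulmxA FF mulmx1 subrr.
have u0 : u != 0.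
  by apply: contra wNF; rewrite subr_eq0 => /eqP ->; exact: submxMl.
pose q := (u *m u^T) 0 0; have q0 : 0 < q by exact: row_mul_tr_gt0.
pose f := (Num.sqrt q)^-1 *: u.
have sq0 : Num.sqrt q != 0 by rewrite sqrtr_eq0 -ltNge.
have FfE : col_mx f F *m (col_mx f F)^T = 1%:M.
  rewrite tr_col_mx mul_col_row FF scalar_mx_block; congr block_mx.
  - rewrite /f linearZ /= -scalemxAl -scalemxAr scalerA -invfM -expr2 sqr_sqrtr ?ltW //.
    by rewrite [u *m _]mx11_scalar -/q -scalemx1 scalerA mulVf ?gt_eqF // scale1r.
  - by rewrite /f -scalemxAl uF scaler0.
  - by rewrite /f linearZ /= -scalemxAr -[F *m _]trmxK trmx_mul trmxK uF trmx0 scaler0.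
exists (col_mx f F) => //.
have FWsub : (W <= col_mx f F)%MS.
  rewrite -[W]vsubmxK -/w -/W' col_mx_sub -!addsmxE -FW addsmxSr andbT.
  have -> : w = Num.sqrt q *: f + w *m F^T *m F.
    by rewrite /f scalerA mulfV // scale1r subrK.
  by apply: addmx_sub_adds; [exact: scalemx_sub|exact: submxMl].
apply/eqmxP; rewrite FWsub andbT -(mxrank_leqif_sup FWsub) (eqP Wfree).
by rewrite eqn_leq rank_leq_row -{1}(eqP Wfree) mxrankS.
Qed.

Lemma row_free_orthonormal d n (F : 'M[R]_(d, n)) : F *m F^T = 1%:M -> row_free F.
Proof. by move=> FF; apply/row_freeP; exists F^T. Qed.

(** The frame chosen in [euclidean_volume] depends on the direction alone. Hence one [F] serves all
    sets with this direction, and their volumes can be compared even though [F] is not explicit. *)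
Lemma euclidean_volume_param d n (W : 'M[R]_(d, n)) : row_free W ->
  exists F : 'M[R]_(d, n), [/\ F *m F^T = 1%:M, (F :=: W)%MS &
    forall (W' : 'M[R]_(d, n)) (a : 'rV[R]_n) (D : set 'rV[R]_d), (W' :=: W)%MS ->
      measurable_rV D -> D 0 -> (forall i, D (delta_mx 0 i)) ->
      euclidean_volume (param a W' D) = (`|\det (W' *m F^T)|%:E * vol D)%E].
Proof.
move=> Wfree; pose V : set 'rV[R]_n := [set v | (v <= W)%MS].
pose X := xget (no_frame R n) [set F | orthonormal_basis V F].
have XV : orthonormal_basis V X.
  have [F FF FW] := gram_schmidt Wfree.
  apply: (@xgetPex _ (no_frame R n) [set F | orthonormal_basis V F]).
  exists (Tagged (fun d => 'M[R]_(d, n)) F); split => //=.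
  by apply/seteqP; split => v /=; rewrite FW.
have XE (W' : 'M[R]_(d, n)) (a : 'rV[R]_n) (D : set 'rV[R]_d) : (W' :=: W)%MS ->
    D 0 -> (forall i, D (delta_mx 0 i)) ->
    euclidean_volume (param a W' D) = vol [set y | param a W' D
      (xget 0 (param a W' D) + y *m tagged X)].
  move=> W'W D0 D1; rewrite /euclidean_volume direction_param //.
  by have -> : [set v : 'rV_n | (v <= W')%MS] = V by apply/seteqP; split => v /=; rewrite W'W.
case: X XV XE => d' F [] /= FF VE XE.
have FW : (F :=: W)%MS.
  apply/eqmxP; apply/andP; split; apply/row_subP => i.
    have : [set v : 'rV_n | (v <= F)%MS] (row i F) by exact: row_sub.
    by rewrite -VE.
  have : V (row i W) by exact: row_sub.
  by rewrite VE.
(* The number of vectors in the chosen frame is the rank of the common row space. *)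
have dd' : d' = d.
  by have /eqP <- := row_free_orthonormal FF; rewrite FW; exact/eqP.
subst d'; exists F; split => // W' a D W'W mD D0 D1.
rewrite XE // vol_param //; first by rewrite W'W FW.
- by rewrite /row_free W'W.
- apply: (@xgetPex _ 0 (param a W' D)); exists a.
  by exists 0; rewrite ?mul0mx ?addr0.
Qed.
End Geometry.

(** * The lattice of integer vectors with zero sum *)

Section Lattice.
Variable R : realType.

Lemma map_intr_mx_inj m n : @injective 'M[R]_(m, n) 'M[int]_(m, n) (map_mx intr).
Proof.
move=> A B /matrixP AB; apply/matrixP => i j; apply: (@intr_inj R).
by have := AB i j; rewrite !mxE.
Qed.

(* The rows e_{j+1} - e_0 span the integer vectors with zero sum. *)
Definition root_mx d : 'M[R]_(d, 1 + d) := row_mx (const_mx (-1)) 1%:M.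

(** The last [d] entries of a row with zero sum are its coefficients in this basis, and its first
    entry is minus their sum. *)
Lemma sum0_root_mx m d (M : 'M[R]_(m, 1 + d)) : (forall i, \sum_j M i j = 0) ->
  M = rsubmx M *m root_mx d.
Proof.
move=> M0; rewrite /root_mx mul_mx_row mulmx1 -[LHS]hsubmxK; congr row_mx.
apply/matrixP => i j; rewrite [RHS]mxE [LHS]mxE ord1.
under eq_bigr do rewrite !mxE mulrN1.
rewrite sumrN; apply/eqP; rewrite -addr_eq0; apply/eqP.
by rewrite -[RHS](M0 i) big_split_ord /= big_ord1.
Qed.

Lemma row_free_root_mx d : row_free (root_mx d).
Proof.
by apply/row_freeP; exists (col_mx 0 1%:M); rewrite mul_row_col mulmx0 add0r mulmx1.
Qed.

(** The root lattice of type A_d. *)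
Definition root_lattice d : set 'rV[R]_(1 + d) :=
  [set v | (v <= root_mx d)%MS /\ exists z : 'rV[int]_(1 + d), v = map_mx intr z].

Lemma root_latticeP d v : @root_lattice d v -> exists c : 'rV[int]_d, v = map_mx intr c *m root_mx d.
Proof.
move=> [/submxP [y vE] [z zE]]; exists (rsubmx z).
have -> : map_mx intr (rsubmx z) = y; last by [].
by rewrite map_rsubmx -zE vE /root_mx mul_mx_row mulmx1 row_mxKr.
Qed.

Lemma lattice_basis_root_mx d :
  lattice_basis (@root_lattice d) (Tagged (fun k => 'M[R]_(k, 1 + d)) (root_mx d)).
Proof.
split => [i|v /root_latticeP [c cE]] /=.
  split; first exact: row_sub.
  exists (row i (row_mx (const_mx (-1)) 1%:M)).
  by rewrite map_row map_row_mx map_const_mx map_mx1 rmorphN1.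
exists c; split => // c'; rewrite cE => /(row_free_inj (row_free_root_mx d)).
exact: map_intr_mx_inj.
Qed.

(** The base changes [V] and [U] between [B] and the standard basis are integer matrices inverse to
    each other. So [B] has [d] rows, and the determinant of [V] is an integer dividing 1. *)
Lemma lattice_basis_unimodular d (B : frame R (1 + d)) :
  lattice_basis (@root_lattice d) B ->
  exists2 V : 'M[R]_d, `|\det V| = 1 &
    B = Tagged (fun k => 'M[R]_(k, 1 + d)) (V *m root_mx d).
Proof.
case: B => b B [/= BL Buniq].
have [v vE] := choice (fun i => root_latticeP (BL i)).
have [u uE] : exists u : 'I_d -> 'rV[int]_b, forall i, row i (root_mx d) = map_mx intr (u i) *m B.
  suff /choice [u uE] : forall i, exists c : 'rV[int]_b, row i (root_mx d) = map_mx intr c *m B.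
    by exists u.
  move=> i; have [c [cE _]] := Buniq _ ((lattice_basis_root_mx d).1 i).
  by exists c.
pose V := \matrix_i v i; pose U := \matrix_i u i.
have VE : B = map_mx intr V *m root_mx d.
  by apply/row_matrixP => i; rewrite row_mul -map_row rowK.
have UE : root_mx d = map_mx intr U *m B.
  by apply/row_matrixP => i; rewrite row_mul -map_row rowK.
have UV : U *m V = 1%:M.
  apply: map_intr_mx_inj; rewrite map_mxM map_mx1.
  apply: (row_free_inj (row_free_root_mx d)).
  by rewrite mul1mx -mulmxA -VE -UE.
have VU : V *m U = 1%:M.
  apply/row_matrixP => i.
  have [c [_ cuniq]] := Buniq _ (BL i).
  rewrite -(cuniq (row i (V *m U))); last first.
    by rewrite map_row -row_mul map_mxM -mulmxA -UE -VE.
  by apply: cuniq; rewrite map_row -row_mul map_mx1 mul1mx.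
have bd : b = d by apply/eqP; rewrite eqn_leq (mulmx1_min VU) (mulmx1_min UV).
subst b; exists (map_mx intr V); last by rewrite VE.
have : \det U * \det V = 1 by rewrite -det_mulmx UV det1.
move=> /(congr1 (fun z : int => `|z|%N)); rewrite abszM => /eqP.
rewrite muln_eq1 => /andP [_ /eqP dV].
by rewrite det_map_mx -intr_norm -abszE dV.
Qed.

(** * Convex hulls of simplex vertices and the relative volume of a simplex *)

Lemma conv_hull_subset_param d n (A : set 'rV[R]_n) (a : 'rV[R]_n) (M : 'M[R]_(d, n)) :
  A `<=` param a M (corner 1) -> conv_hull A `<=` param a M (corner 1).
Proof.
move=> AS; apply: smallest_sub => // x y l; rewrite !inE.
move=> [u [u0 u1] <-] [v [v0 v1] <-].
have l0 : 0 <= l%:num by [].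
have l1 : 0 <= 1 - l%:num by rewrite subr_ge0.
exists (l%:num *: u + (1 - l%:num) *: v).
  split => [i|]; first by rewrite !mxE addr_ge0 // mulr_ge0.
  under eq_bigr do rewrite !mxE; rewrite big_split /= -!mulr_sumr.
  by rewrite (le_trans (lerD (ler_wpM2l l0 u1) (ler_wpM2l l1 v1))) // !mulr1 addrC subrK.
rewrite mulmxDl -!scalemxAl /conv /= !scalerDr addrACA; congr (_ + _).
by rewrite -scalerDl addrC subrK scale1r.
Qed.

(** Induction on the number of rows: a point of the simplex is a convex combination of the vertex
    [a + row 0 M], with weight [t], and of a point of the simplex on the remaining vertices. *)
Lemma param_corner_subset_convex d n (a : 'rV[R]_n) (M : 'M[R]_(d, n)) (C : set 'rV[R]_n) :
  convex_set (C : set (convex_lmodType 'rV[R]_n)) -> C a -> (forall i, C (a + row i M)) ->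
  param a M (corner 1) `<=` C.
Proof.
move=> Cconv Ca; elim: d => [|d IHd] in M *.
  by move=> _ _ [x _ <-]; rewrite [x]thinmx0 mul0mx addr0.
rewrite -[d.+1]/(1 + d)%N in M * => CM _ [x [x0 x1] <-].
have CM' i : C (a + row i (dsubmx M)).
  by rewrite row_dsubmx; exact: CM.
pose t := x 0 (lshift d 0); pose y := rsubmx x.
have yE i : y 0 i = x 0 (rshift 1 i) by rewrite mxE.
have y0 i : 0 <= y 0 i by rewrite yE.
have ys : t + \sum_i y 0 i <= 1.
  by move: x1; rewrite big_split_ord /= big_ord1; under [X in _ + X <= _]eq_bigr do rewrite -yE.
have ysum : 0 <= \sum_i y 0 i by apply: sumr_ge0 => i _.
have xM : x *m M = t *: row (lshift d 0) M + y *m dsubmx M.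
  rewrite -{1}[x]hsubmxK -{1}[M]vsubmxK mul_row_col; congr (_ + _).
  have -> : lsubmx x = t%:M by rewrite [lsubmx x]mx11_scalar mxE.
  by rewrite mul_scalar_mx; congr (_ *: _); apply/rowP => j; rewrite !mxE.
have t0 : 0 <= t by exact: x0.
have t1 : t <= 1 by rewrite (le_trans _ ys) // lerDl.
(* For [t = 1] the other weights vanish; otherwise they are rescaled by [(1 - t)^-1], which brings
   their sum back to at most 1. *)
have [te|tn1] := eqVneq t 1.
  have -> : a + x *m M = a + row (lshift d 0) M; last exact: CM.
  have yz : y = 0.
    apply/rowP => i; rewrite [RHS]mxE; move: ys; rewrite te gerDl => ys'.
    have : \sum_i y 0 i == 0 by rewrite eq_le ys' ysum.
    by rewrite psumr_eq0 // => /allP /(_ i (mem_index_enum i))  /eqP.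
  by rewrite xM te scale1r yz mul0mx addr0.
have st0 : 0 < 1 - t by rewrite subr_gt0 lt_neqAle tn1.
have Cy : C (a + (1 - t)^-1 *: y *m dsubmx M).
  apply: IHd => //; exists ((1 - t)^-1 *: y) => //; split => [i|].
    by rewrite mxE mulr_ge0 // invr_ge0 ltW.
  under eq_bigr do rewrite mxE; rewrite -mulr_sumr ler_pdivrMl // mulr1.
  by rewrite lerBrDl.
have := Cconv (a + row (lshift d 0) M) (a + (1 - t)^-1 *: y *m dsubmx M) (Itv01 t0 t1)
  (mem_set (CM (lshift d 0))) (mem_set Cy).
rewrite inE /conv /=; congr C; rewrite /= !scalerDr addrACA -scalerDl addrC.
rewrite [t + _]addrC subrK scale1r addrC; congr (_ + _).
by rewrite xM -!scalemxAl scalerA mulfV ?gt_eqF // scale1r.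
Qed.

Lemma corner0 d : @corner R d 1 0.
Proof. by split => [i|]; rewrite ?mxE // big1 // => i _; rewrite mxE. Qed.

Lemma corner_delta d (i : 'I_d) : @corner R d 1 (delta_mx 0 i).
Proof.
split => [j|]; first by rewrite mxE ler0n.
rewrite (bigD1 i) //= big1 => [|j ji]; rewrite mxE !eqxx ?addr0 //.
by rewrite (negPf ji).
Qed.

Lemma cube0 d : @cube R d 0.
Proof. by move=> i; rewrite mxE lexx ler01. Qed.

Lemma cube_delta d (i : 'I_d) : @cube R d (delta_mx 0 i).
Proof. by move=> j; rewrite mxE ler0n lern1 leq_b1. Qed.

Lemma conv_hull_param d n (A : set 'rV[R]_n) (a : 'rV[R]_n) (M : 'M[R]_(d, n)) :
  A = a |` [set a + row i M | i in setT] -> conv_hull A = param a M (corner 1).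
Proof.
move=> AE; apply/seteqP; split.
  apply: conv_hull_subset_param; rewrite AE => _ [->|[i _ <-]].
    by exists 0; rewrite ?mul0mx ?addr0 //; exact: corner0.
  by exists (delta_mx 0 i); rewrite ?rowE //; exact: corner_delta.
move=> x Sx C [Cconv AC]; apply: (param_corner_subset_convex Cconv) Sx.
  by apply: AC; rewrite AE; left.
by move=> i; apply: AC; rewrite AE; right; exists i.
Qed.
Lemma parallelepipedE n (B : frame R n) : parallelepiped B = param 0 (tagged B) (@cube R _).
Proof. by apply/seteqP; split => _ [x cx <-]; exists x; rewrite ?add0r. Qed.

(** The simplex and the fundamental parallelepiped have the same direction, so they are measured in
    the same frame [F]. The factor [|\det (root_mx d *m F^T)|] occurs in both volumes and cancels,
    and the unimodular [V] contributes 1. *)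
Lemma relative_volume_param d (a : 'rV[R]_(1 + d)) (N : 'M[R]_d) : N \in unitmx ->
  relative_volume (param a (N *m root_mx d) (corner 1)) = (`|\det N| / d`!%:R)%:E.
Proof.
move=> uN; set S := param _ _ _.
have [F [FF FB volE]] := euclidean_volume_param (row_free_root_mx d).
have mulE (V : 'M[R]_d) : V \in unitmx -> (V *m root_mx d :=: root_mx d)%MS.
  by move=> uV; apply: eqmxMfull; rewrite row_full_unit.
have LE : parallel_lattice S = @root_lattice d.
  rewrite /parallel_lattice direction_param; [|exact: corner0|exact: corner_delta].
  by apply/seteqP; split => v /=; rewrite mulE.
rewrite /relative_volume LE.
set B := xget _ _.
have [V V1 ->] : exists2 V : 'M[R]_d, `|\det V| = 1 &
    B = Tagged (fun k => 'M[R]_(k, 1 + d)) (V *m root_mx d).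
  apply: lattice_basis_unimodular; apply: (@xgetPex _ _ [set B | lattice_basis _ B]).
  by exists (Tagged (fun k => 'M[R]_(k, 1 + d)) (root_mx d)); exact: lattice_basis_root_mx.
have uV : V \in unitmx by rewrite unitmxE unitfE -normr_eq0 V1 oner_eq0.
rewrite parallelepipedE /=.
rewrite [euclidean_volume S]volE;
  [|exact: mulE|exact: measurable_rV_corner|exact: corner0|exact: corner_delta].
rewrite volE; [|exact: mulE|exact: measurable_rV_cube|exact: cube0|exact: cube_delta].
rewrite vol_cube mule1 vol_corner // expr1n -!mulmxA !det_mulmx !normrM V1 mul1r mul1r.
(* [c] is the Euclidean volume of the fundamental parallelepiped; it must be nonzero for the
   division of extended reals to cancel it. *)
set c := `|\det (root_mx d *m F^T)|.
have c0 : c != 0.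
  rewrite normr_eq0 -unitfE -unitmxE.
  by apply: unitmx_mul_orthonormal; rewrite ?FB // row_free_root_mx.
by rewrite inver (negPf c0) -!EFinM mulrAC mulfK.
Qed.
End Lattice.

(** * Stack-sorting Ln1 words *)

Section StackSort.

Lemma stack_step_perm st x :
  perm_eq ((stack_step st x).2 ++ (stack_step st x).1) (x :: st.2 ++ st.1).
Proof.
rewrite /stack_step /=; set k := find _ _.
by rewrite -(cat1s x (drop _ _)) perm_catCA perm_cons -catA cat_take_drop.
Qed.

Lemma foldl_stack_step_perm w st :
  let st' := foldl stack_step st w in
  perm_eq (st'.2 ++ st'.1) (w ++ st.2 ++ st.1).
Proof.
elim: w st => [|x w IHw] st //=.
apply: (perm_trans (IHw _)); rewrite -[X in perm_eq _ X]cat1s perm_sym perm_catCA.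
by rewrite perm_cat2l perm_sym stack_step_perm.
Qed.

Lemma perm_stack_sort w : perm_eq (stack_sort w) w.
Proof. by have := foldl_stack_step_perm w ([::], [::]); rewrite cats0. Qed.

Lemma stack_step_max st x : all (fun t => (t < x)%N) st.1 ->
  stack_step st x = ([:: x], st.2 ++ st.1).
Proof.
move=> H; rewrite /stack_step /=.
have -> : find (fun t => ~~ (t < x)%N) st.1 = size st.1.
  apply: hasNfind; rewrite -all_predC; apply: sub_all H => t /=.
  by rewrite negbK.
by rewrite drop_size take_size.
Qed.

(** A new maximum empties the stack exactly as the end of the input would, so the output at that
    moment is [stack_sort w]. *)
Lemma foldl_stack_step_max w x : all (fun t => (t < x)%N) w ->
  foldl stack_step ([::], [::]) (w ++ [:: x]) = ([:: x], stack_sort w).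
Proof.
move=> H; rewrite foldl_cat /= stack_step_max //.
have := foldl_stack_step_perm w ([::], [::]); rewrite cats0 => /perm_all E.
by move: H; rewrite -E all_cat => /andP [].
Qed.

(** No later entry exceeds [x], so popping never goes past it and it stays at the bottom of the
    stack. *)
Lemma foldl_stack_step_bottom x w s out : all (fun t => (t < x)%N) w ->
  exists s' out', foldl stack_step (s ++ [:: x], out) w = (s' ++ [:: x], out').
Proof.
elim: w s out => [|y w IHw] s out /=; first by move=> _; exists s, out.
move=> /andP [yx wx]; rewrite /stack_step /=.
set k := find _ _.
have ks : (k <= size s)%N.
  rewrite /k find_cat; case: ifP => [|_]; first by move=> h; rewrite ltnW // -has_find.
  by rewrite /= -leqNgt (ltnW yx) addn0.
rewrite drop_cat; case: ltnP => ks'.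
  by rewrite -cat_cons; apply: IHw.
have -> : (k - size s = 0)%N by apply/eqP; rewrite subn_eq0.
by rewrite drop0 -(cat1s y [:: x]); apply: IHw.
Qed.

(** The maximum [x] flushes [u], stays at the bottom of the stack while [v] is read, and is popped
    last. *)
Lemma stack_sort_last x u v : all (fun t => (t < x)%N) u -> all (fun t => (t < x)%N) v ->
  exists w, stack_sort (u ++ x :: v) = w ++ [:: x].
Proof.
move=> ux vx; rewrite /stack_sort -cat1s catA foldl_cat foldl_stack_step_max //.
have [s' [out' E]] := @foldl_stack_step_bottom x v [::] (stack_sort u) vx.
by rewrite -[X in foldl _ X _]/([::] ++ [:: x], stack_sort u) E /= catA; exists (out' ++ s').
Qed.

(** Along an increasing run each entry pops its predecessor. The forms [last] and [belast] cover the
    empty run, which leaves [a] on the stack. *)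
Lemma foldl_stack_step_iota out m a r : (a < m)%N ->
  foldl stack_step ([:: a], out) (iota m r) =
  ([:: last a (iota m r)], out ++ belast a (iota m r)).
Proof.
elim: r m a out => [|r IHr] m a out am /=; first by rewrite cats0.
by rewrite stack_step_max /= ?am // IHr // -catA.
Qed.

(** The entry [m] flushes [L], then 1 is pushed on top of [m]. The next entry, or the end of the
    input, pops 1 before [m], and the increasing tail passes through unchanged. *)
Lemma stack_sort_Ln1 L m r : (1 < m)%N -> all (fun t => (1 < t < m)%N) L ->
  stack_sort (L ++ [:: m; 1%N] ++ iota m.+1 r) = stack_sort L ++ 1%N :: iota m r.+1.
Proof.
move=> m1 LH; have Lm : all (fun t => (t < m)%N) L by apply: sub_all LH => t /andP [].
rewrite /stack_sort -[[:: m; 1%N]]/([:: m] ++ [:: 1%N]) -catA catA foldl_cat foldl_stack_step_max //=.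
have -> : stack_step ([:: m], stack_sort L) 1 = ([:: 1%N; m], stack_sort L).
  by rewrite /stack_step /= -leqNgt (ltnW m1) /= cats0.
rewrite -/(stack_sort L); case: r => [|r] //=.
rewrite stack_step_max /= ?ltnS ?(ltnW m1) ?leqnn //=.
rewrite foldl_stack_step_iota //= -!catA; by congr (_ ++ _); rewrite /= cats1 -lastI.
Qed.

(* The Ln1 words of length m+2 are the case r = 0. *)
Definition Ln1_word (m r : nat) (w : seq nat) :=
  exists2 L, perm_eq L (iota 2 m) & w = L ++ [:: m.+2; 1%N] ++ iota m.+3 r.

Lemma iota2S m : iota 2 m.+1 = iota 2 m ++ [:: m.+2].
Proof. by rewrite -[m.+1 in LHS]addn1 iotaD add2n. Qed.

(** The maximum [m.+2] of [L] comes last in [stack_sort L], hence just before the entry 1: the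
    pattern recurs with one more entry in the sorted tail. *)
Lemma stack_sort_Ln1_word m r w : Ln1_word m.+1 r w -> Ln1_word m r.+1 (stack_sort w).
Proof.
move=> [L LP ->].
have LH t : t \in L -> (1 < t < m.+3)%N by rewrite (perm_mem LP) mem_iota /= addSn.
rewrite stack_sort_Ln1 //; last by apply/allP.
have xL : m.+2 \in L by rewrite (perm_mem LP) mem_iota /= addSn addnS ltnSn.
have Lu : uniq L by rewrite (perm_uniq LP) iota_uniq.
have Lmax t : t \in L -> t != m.+2 -> (t < m.+2)%N.
  by move=> /LH /andP [_]; rewrite ltnS leq_eqVlt => /orP [->|].
case/splitPr: xL LP LH Lu Lmax => u v LP LH Lu Lmax.
have [||w0 wE] := @stack_sort_last m.+2 u v.
- apply/allP => t tu; apply: Lmax; first by rewrite mem_cat tu.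
  move: Lu; rewrite cat_uniq => /and3P [_ /hasPn /(_ m.+2) + _].
  by rewrite mem_head => /(_ isT); apply: contra => /eqP <-.
- apply/allP => t tv; apply: Lmax; first by rewrite mem_cat inE tv !orbT.
  move: Lu; rewrite cat_uniq => /and3P [_ _ /= /andP [+ _]].
  by apply: contra => /eqP <-.
exists w0; last by rewrite wE -catA.
have : perm_eq (w0 ++ [:: m.+2]) (iota 2 m ++ [:: m.+2]).
  by rewrite -iota2S -wE (perm_trans (perm_stack_sort _)).
by rewrite perm_cat2r.
Qed.

(** Here [L] is empty and the word is 2 1 3 4 ..., which a single pass sorts. *)
Lemma stack_sort_Ln1_word0 r w : Ln1_word 0 r w -> stack_sort w = iota 1 (r.+2).
Proof.
move=> [L /perm_nilP -> ->]; by rewrite (@stack_sort_Ln1 [::] 2 r).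
Qed.

Lemma iter_stack_sort_Ln1_word m r w k : Ln1_word (k + m) r w ->
  Ln1_word m (k + r) (iter k stack_sort w).
Proof.
elim: k m => [|k IHk] m //=.
rewrite addSnnS => /IHk H; exact: stack_sort_Ln1_word.
Qed.

Lemma perm_iota_Ln1 m : perm_eq (iota 1 m.+2) (iota 2 m ++ [:: m.+2; 1%N]).
Proof. by rewrite -[iota 1 m.+2]/([:: 1%N] ++ iota 2 m.+1) iota2S perm_catC -catA. Qed.

(** In the matrix of vertex differences, the first fact gives the diagonal, the second the zeros
    beyond it, and the third the vanishing row sums. *)
Lemma nth_Ln1_word m r w : Ln1_word m r w ->
  [/\ nth 0%N w m.+1 = 1%N, forall i, (m.+1 < i < m.+2 + r)%N -> nth 0%N w i = i.+1 &
    perm_eq w (iota 1 (m.+2 + r))].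
Proof.
move=> [L LP wE]; have sL : size L = m by rewrite (perm_size LP) size_iota.
split.
- by rewrite wE nth_cat sL ltnNge leqnSn /= subSn // subnn.
- move=> i /andP [mi ir]; rewrite wE catA nth_cat size_cat sL addn2 ltnNge mi /=.
  by rewrite nth_iota ?ltn_subLR // addSn subnKC.
- rewrite wE (perm_trans (_ : perm_eq _ (iota 2 m ++ [:: m.+2; 1%N] ++ iota m.+3 r))) ?perm_cat2r //.
  by rewrite iotaD add1n catA perm_cat2r perm_sym perm_iota_Ln1.
Qed.
End StackSort.

(** * The orbit of an Ln1 permutation and its vertex matrix *)

Section Ln1.

Lemma perm_word n (p : 'S_n) : perm_eq (word p) (iota 1 n).
Proof.
apply: uniq_perm; rewrite ?iota_uniq //.
  by rewrite map_inj_uniq ?enum_uniq // => i j [] /val_inj /perm_inj.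
move=> x; rewrite mem_iota add1n ltnS; apply/mapP/andP => [[i _ ->]|[x0 xn]].
  by split => //; exact: ltn_ord.
have xn' : (x.-1 < n)%N by rewrite prednK.
exists ((p^-1)%g (Ordinal xn')); first by rewrite mem_enum.
by rewrite permKV /= prednK.
Qed.

Lemma Ln1_word_word m (p : 'S_(m.+2)) : is_Ln1 p -> Ln1_word m 0 (word p).
Proof.
move=> [/= nth_m nth_m1]; have sw : size (word p) = m.+2 by rewrite size_map size_enum_ord.
have wE : word p = take m (word p) ++ [:: m.+2; 1%N].
  rewrite -[LHS](cat_take_drop m); congr (_ ++ _).
  rewrite (drop_nth 0%N) ?sw // nth_m (drop_nth 0%N) ?sw // nth_m1.
  by rewrite drop_oversize // sw.
exists (take m (word p)) => //.
rewrite -(perm_cat2r [:: m.+2; 1%N]) -wE.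
by rewrite (perm_trans (perm_word p)) // perm_iota_Ln1.
Qed.

Variable R : realType.

Lemma sum_point n (w : seq nat) : perm_eq w (iota 1 n) ->
  \sum_i Defs.point R n w 0 i = \sum_(x <- iota 1 n) x%:R.
Proof.
move=> wP; rewrite -(perm_big _ wP) (big_nth 0%N) (perm_size wP) size_iota big_mkord.
by apply: eq_bigr => i _; rewrite mxE.
Qed.

Section Orbit.
Variables (m : nat) (p : 'S_(m.+2)).
Hypothesis pLn1 : is_Ln1 p.

Let e := Defs.point R m.+2 (iota 1 m.+2).
Let w k := iter k stack_sort (word p).
(* The rows are listed from the last iterate to the first, which makes the
   coordinates lower triangular. *)
Let M : 'M[R]_(m.+1, 1 + m.+1) := \matrix_j (Defs.point R m.+2 (w (m - j)) - e).

Let wLn1 k : (k <= m)%N -> Ln1_word (m - k) k (w k).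
Proof.
move=> km; rewrite -[k in Ln1_word _ k]addn0; apply: iter_stack_sort_Ln1_word.
by rewrite subnKC //; exact: Ln1_word_word.
Qed.

Let w_last : w m.+1 = iota 1 m.+2.
Proof. by apply: stack_sort_Ln1_word0; have := wLn1 (leqnn m); rewrite subnn. Qed.

(** The zero-based position [(m - k).+1] holds 1 in [w k] but [(m - k).+2] in the identity. So the
    orbit does not stop before step [m.+1]. *)
Let w_neq k : (k <= m)%N -> w k <> iota 1 m.+2.
Proof.
by move=> km wE; have [] := nth_Ln1_word (wLn1 km); rewrite wE nth_iota ?ltnS ?leq_subr.
Qed.

Lemma stack_orbit_Ln1 : stack_orbit R p = e |` [set e + row i M | i in setT].
Proof.
have rE (i : 'I_m.+1) : e + row i M = Defs.point R m.+2 (w (m - i)).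
  by rewrite rowK addrC subrK.
apply/seteqP; split => [_ [k kP <-]|_ [->|[i _ <-]]].
(* Since [w m.+1] is the identity, the stopping condition excludes all larger indices. *)
- have : (k <= m.+1)%N.
    by rewrite leqNgt; apply/negP => /kP; exact.
  rewrite leq_eqVlt => /orP [/eqP ->|km]; first by left; rewrite -/(w m.+1) w_last.
  have mk : (m - k < m.+1)%N by rewrite ltnS leq_subr.
  by right; exists (Ordinal mk) => //; rewrite rE /= subKn.
- by exists m.+1; [move=> j jm; exact: w_neq|rewrite -/(w m.+1) w_last].
- exists (m - i)%N; last by rewrite rE.
  move=> j jm; apply: w_neq; apply: ltnW; exact: leq_trans jm (leq_subr _ _).
Qed.

(** Every iterate is a rearrangement of 1, ..., m+2, so its difference with the identity has zero
    sum. *)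
Lemma vertex_mxE : M = rsubmx M *m root_mx R m.+1.
Proof.
have ME i j : M i j = Defs.point R m.+2 (w (m - i)) 0 j - e 0 j by rewrite !mxE.
apply: sum0_root_mx => i; under eq_bigr do rewrite ME.
have [_ _ wP] := nth_Ln1_word (wLn1 (leq_subr i m)).
rewrite big_split /= sumrN !sum_point ?subrr //.
by move: wP; rewrite !addSn subnK // leq_subr.
Qed.

(** Row [i] comes from the iterate [m - i], which has 1 in zero-based position [i + 1] and agrees
    with the identity after it. As [rsubmx] drops the first column, the matrix is lower triangular
    with diagonal entries [1 - (i + 2) = -(i + 1)]. *)
Lemma norm_det_vertex_mx : `|\det (rsubmx M)| = (m.+1)`!%:R.
Proof.
have ME (i j : 'I_m.+1) : rsubmx M i j = (nth 0%N (w (m - i)) j.+1)%:R - j.+2%:R.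
  rewrite !mxE nth_iota; last exact: (ltn_ord (rshift 1 j)).
  by rewrite /= !add1n.
have im (i : 'I_m.+1) : (m - (m - i))%N = i by rewrite subKn // -ltnS.
rewrite det_trig; last first.
  apply/is_trig_mxP => i j ij; rewrite ME.
  have [_ + _] := nth_Ln1_word (wLn1 (leq_subr i m)); rewrite im => ->; first by rewrite subrr.
  have im' : (i <= m)%N by rewrite -ltnS.
  by rewrite ltnS ij !addSn subnKC // ltnS /= ltn_ord.
rewrite (big_morph _ (@normrM R) (@normr1 R)) fact_prod big_add1 big_mkord natr_prod.
apply: eq_bigr => i _.
rewrite ME; have [+ _ _] := nth_Ln1_word (wLn1 (leq_subr i m)); rewrite im => ->.
by rewrite distrC -natrB // subn1 normr_nat.
Qed.
End Orbit.
End Ln1.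

Theorem theorem4p6 (R : realType) (n : nat) (p : 'S_n) :
  (2 <= n)%N -> is_Ln1 p ->
  relative_volume (conv_hull (stack_orbit R p)) = 1%E.
Proof.
case: n p => [|[|m]] // p _ pLn1.
rewrite (conv_hull_param (stack_orbit_Ln1 R pLn1)) (vertex_mxE R pLn1).
rewrite relative_volume_param; last first.
  by rewrite unitmxE unitfE -normr_eq0 (norm_det_vertex_mx R pLn1) pnatr_eq0 -lt0n fact_gt0.
by rewrite (norm_det_vertex_mx R pLn1) mulfV // pnatr_eq0 -lt0n fact_gt0.
Qed.
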